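(* Let $d \geq 1$. Suppose $X \subseteq \mathbb{R}^d$, and $E$ is an equivalence relation on $X$ with infinitely many classes, each class infinite. Suppose that, considered as a subset of $\mathbb{C}^d$, $X$ is $(\Delta_d, E)$-indiscernible (in the structure $(\mathbb{C},+,\cdot,0,1)$). Then there is $2 \leq a_* \leq d+1$ such that each $E$-equivalence class is strictly $a_*$-rainbow, and $X$ is strongly $a$-rainbow for all $2 \leq a \leq a_*$.
   Context: The volume of an $a$-element set of points of $\mathbb{R}^d$ ($a \geq 2$) is the $(a-1)$-dimensional volume of the simplex they span; it is $0$ exactly when the points are affinely dependent. A set $Z \subseteq \mathbb{R}^d$ is strongly $a$-rainbow if all $a$-element subsets of $Z$ yield nonzero volumes, and distinct $a$-element subsets yield distinct volumes. $Z$ is strictly $a$-rainbow if $Z$ is strongly $a'$-rainbow for all $2 \leq a' \leq a$, and $Z$ is a subset of an $(a-1)$-dimensional affine subspace of $\mathbb{R}^d$. For $2 \leq a \leq d+1$, let $q_a(v_0,\ldots,v_{a-1})$ (each $v_i$ a $d$-tuple of variables) be the Cayley-Menger determinant, a polynomial in the coordinates: for real points, the square of the volume of $(v_0,\ldots,v_{a-1})$ is a fixed positive constant times $|q_a(v_0,\ldots,v_{a-1})|$, so the volume is $0$ iff $q_a = 0$. Explicitly, $q_a$ is the determinant of the $(a+1)\times(a+1)$ symmetric matrix with zero diagonal, all other entries of the first row and column equal to $1$, and remaining entries $\sum_{k<d}(v_{i,k}-v_{j,k})^2$ for $i,j<a$. Let $$p_a(\overline{v},\overline{w}) = (q_a(\overline{v})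 - q_a(\overline{w}))(q_a(\overline{v})+q_a(\overline{w})),$$ so that for real tuples, $\overline{v},\overline{w}$ have the same volume iff $p_a(\overline{v},\overline{w})=0$. $\Delta_d$ is the finite set of formulas $q_a(\overline{v})=0$ and $p_a(\overline{v},\overline{w})=0$, for $2 \leq a \leq d+1$, in the language of fields. $X \subseteq \mathbb{C}^d$ is $(\Delta_d,E)$-indiscernible if for every $n<\omega$ and all sequences $\overline{a}_0,\ldots,\overline{a}_{n-1}$ of pairwise distinct elements of $X$ and $\overline{b}_0,\ldots,\overline{b}_{n-1}$ of pairwise distinct elements of $X$ such that for all $i<j<n$, $\overline{a}_i\,E\,\overline{a}_j$ iff $\overline{b}_i\,E\,\overline{b}_j$, the two sequences satisfy the same formulas of $\Delta_d$ in $(\mathbb{C},+,\cdot,0,1)$. Here the point-variables of a formula of $\Delta_d$ may be assigned to entries of the sequence in any way, possibly with repetitions; e.g. the truth of $p_a(\overline{a}_{i_0},\ldots,\overline{a}_{i_{a-1}},\overline{a}_{j_0},\ldots,\overline{a}_{j_{a-1}})=0$ is the same as for the $\overline{b}$'s, for all indices $i_0,\ldots,j_{a-1}<n$. *)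

(* Defs.v *)
From HB Require Import structures.
From mathcomp Require Import all_boot all_order all_algebra.
From mathcomp Require Import finmap.
From mathcomp Require Import boolp classical_sets functions cardinality reals.
From mathcomp Require Import complex.

Set Implicit Arguments.
Unset Strict Implicit.
Unset Printing Implicit Defensive.

Import Order.TTheory GRing.Theory Num.Theory.
Local Open Scope classical_set_scope.
Local Open Scope ring_scope.

Section Volume.
Context {R : realType} {d : nat}.

(* For s = [:: s_0; ...; s_k], the rows are the edge vectors s_(i+1) - s_0. *)
Definition edge_mx (s : seq 'rV[R]_d) : 'M[R]_((size s).-1, d) :=
  \matrix_(i < (size s).-1) (s`_i.+1 - s`_0).

(* The k-dimensional volume of the simplex with k.+1 vertices s is 1/k! times
   that of the parallelotope on its edge vectors at s_0, the square root of
   their Gram determinant.  It does not depend on the order of the vertices. *)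
Definition simplex_volume (s : seq 'rV[R]_d) : R :=
  Num.sqrt (\det (edge_mx s *m (edge_mx s)^T)) / ((size s).-1)`!%:R.

Definition volume (A : {fset 'rV[R]_d}) : R := simplex_volume (enum_fset A).

Definition strongly_rainbow (a : nat) (Z : set 'rV[R]_d) : Prop :=
  (forall A : {fset 'rV[R]_d},
      [set` A] `<=` Z -> #|` A| = a -> volume A <> 0) /\
  (forall A B : {fset 'rV[R]_d},
      [set` A] `<=` Z -> [set` B] `<=` Z -> #|` A| = a -> #|` B| = a ->
      A <> B -> volume A <> volume B).

Definition strictly_rainbow (a : nat) (Z : set 'rV[R]_d) : Prop :=
  (forall b : nat, (2 <= b <= a)%N -> strongly_rainbow b Z) /\
  (exists (p : 'rV[R]_d) (W : {vspace 'rV[R]_d}),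
      \dim W = a.-1 /\ forall z, Z z -> z - p \in W).

End Volume.

Section Delta.
Context {K : comNzRingType} {d : nat}.

Definition sqdist (x y : 'rV[K]_d) : K := \sum_(k < d) (x 0 k - y 0 k) ^+ 2.

Definition cayley_menger (a : nat) (v : 'I_a -> 'rV[K]_d) : K :=
  \det (block_mx (0 : 'M[K]_1) (const_mx 1)
                 (const_mx 1) (\matrix_(i, j) sqdist (v i) (v j))
        : 'M[K]_(1 + a)).

Definition cm_pair (a : nat) (v w : 'I_a -> 'rV[K]_d) : K :=
  (cayley_menger v - cayley_menger w) * (cayley_menger v + cayley_menger w).

(* The index maps i and j assign entries of the sequences, possibly with
   repetitions, to the point-variables of the formulas. *)
Definition same_Delta (n : nat) (x y : 'I_n -> 'rV[K]_d) : Prop :=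
  forall a : nat, (2 <= a <= d.+1)%N ->
    (forall i : 'I_a -> 'I_n,
        cayley_menger (x \o i) = 0 <-> cayley_menger (y \o i) = 0) /\
    (forall i j : 'I_a -> 'I_n,
        cm_pair (x \o i) (x \o j) = 0 <-> cm_pair (y \o i) (y \o j) = 0).

Definition Delta_indiscernible (X : set 'rV[K]_d)
    (E : 'rV[K]_d -> 'rV[K]_d -> Prop) : Prop :=
  forall (n : nat) (x y : 'I_n -> 'rV[K]_d),
    injective x -> injective y ->
    (forall i, X (x i)) -> (forall i, X (y i)) ->
    (forall i j : 'I_n, (i < j)%N -> (E (x i) (x j) <-> E (y i) (y j))) ->
    same_Delta x y.

End Delta.

Section EquivalenceOn.
Context {T : Type}.

(* Only the restriction of E to X matters. *)
Definition equivalence_on (X : set T) (E : T -> T -> Prop) : Prop :=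
  [/\ forall x, X x -> E x x,
      forall x y, X x -> X y -> E x y -> E y x
    & forall x y z, X x -> X y -> X z -> E x y -> E y z -> E x z].

Definition eclass (X : set T) (E : T -> T -> Prop) (x : T) : set T :=
  [set y | X y /\ E x y].

Definition eclasses (X : set T) (E : T -> T -> Prop) : set (set T) :=
  [set eclass X E x | x in X].

End EquivalenceOn.

Section Complexification.
Context {R : realType} {d : nat}.

Definition to_complex (x : 'rV[R]_d) : 'rV[R[i]]_d :=
  map_mx (fun t : R => real_complex R t) x.

Definition rel_to_complex (E : 'rV[R]_d -> 'rV[R]_d -> Prop)
    (u v : 'rV[R[i]]_d) : Prop :=
  exists x y : 'rV[R]_d, [/\ u = to_complex x, v = to_complex y & E x y].

End Complexification.

(* Main.v *)
Require Import Defs.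
From mathcomp Require Import all_boot all_order all_algebra.
From mathcomp Require Import fingroup perm finmap.
From mathcomp Require Import boolp classical_sets functions cardinality reals.
From mathcomp Require Import complex ring lra.

(** The plan is to work with the Gram determinant of a list of points, the
    square of the volume up to a positive factor.  It is a nonzero constant
    times the Cayley-Menger determinant and it is nonnegative, so the
    hypothesis says: the vanishing of Gram determinants, and the equality of
    two of them, is preserved by every injective map between finite subsets of
    X that preserves E ([gram_indiscernible]).

    Let a be the largest size of a list of points in one class with nonzero
    Gram determinant.  By indiscernibility every list of a distinct points of
    one class is then affinely independent, and by maximality each class lies
    in the flat spanned by any a of its points; this flat has dimension a - 1.

    Any b <= a distinct points of X are affinely independent
    ([gram_uniq_neq0]).  Take a dependent list of least length, and let z be
    one of its points.  Every point of the class of z may replace z, so a large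
    part of that class lies in the flat of the other b - 1 points; but it
    contains a independent points, and this flat has dimension b - 2.

    Suppose that two distinct b-element subsets A and B of X have the same
    volume, where b <= a, and pick p in A outside B.  Replacing p by a fresh
    point p' of its class shows that A \ {p} spans the same volume with p and
    with p'; by indiscernibility this holds for all configurations of the same
    pattern.  So one can produce arbitrarily many lists L_i of b - 1 points,
    with x_i in L_i and y_i in the class of x_i but not in L_i, such that
    (L_j, x_i, y_i) has that pattern whenever j <> i.  The function
    z |-> gram (L_j, z) is a polynomial of degree 2 in z, so the matrix with
    entries gram (L_j, x_i) - gram (L_j, y_i) has bounded rank.  It vanishes
    off the diagonal, and its diagonal entries are the nonzero numbers
    - gram (L_i, y_i): a contradiction ([no_gram_family]).  If A \ {p} meets
    the class of p at r, the L_i differ only in the image x_i of r, and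
    infinitely many points in that class suffice
    ([gram_neq_same_class]).  Otherwise a whole class of A \ {p} is moved to
    fresh classes, and it is here that infinitely many classes are needed
    ([gram_neq_other_class]). *)

Set Implicit Arguments.
Unset Strict Implicit.
Unset Printing Implicit Defensive.
Import Order.TTheory GRing.Theory Num.Theory.
Local Open Scope classical_set_scope.
Local Open Scope ring_scope.

(** * Gram matrices *)

Lemma det_schur (F : fieldType) k (a : 'M[F]_1) (u : 'rV[F]_k) (v : 'cV[F]_k)
    (M : 'M[F]_k) : M \in unitmx ->
  \det (block_mx a u v M) = \det M * (a - u *m invmx M *m v) 0 0.
Proof.
move=> uM.
have -> : block_mx a u v M =
    block_mx 1%:M (u *m invmx M) 0 1%:M *m
    block_mx (a - u *m invmx M *m v) 0 v M.
  by rewrite mulmx_block !mul1mx !mul0mx ?mulmx0 !add0r subrK mulmxKV.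
by rewrite det_mulmx det_ublock det_lblock !det1 !mul1r det_mx11 mulrC.
Qed.

Section GramMatrix.
Context {R : realFieldType}.

Lemma dotmx_eq0 n (w : 'rV[R]_n) : ((w *m w^T) 0 0 == 0) = (w == 0).
Proof.
apply/eqP/eqP => [|->]; last by rewrite mul0mx mxE.
rewrite mxE => /eqP; rewrite psumr_eq0 => [/allP w0|i _]; last first.
  by rewrite mxE -expr2 sqr_ge0.
apply/rowP => i; have := w0 i (mem_index_enum i).
by rewrite !mxE -expr2 sqrf_eq0 => /eqP.
Qed.

Lemma dotmx_ge0 n (w : 'rV[R]_n) : 0 <= (w *m w^T) 0 0.
Proof. by rewrite mxE sumr_ge0 // => i _; rewrite mxE -expr2 sqr_ge0. Qed.

(** Over an ordered field v *m A *m A^T = 0 forces the squared norm of v *m A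
    to vanish. *)
Lemma gram_unitmx m n (A : 'M[R]_(m, n)) :
  (A *m A^T \in unitmx) = row_free A.
Proof.
rewrite -row_free_unit; apply/idP/idP => fA; apply: inj_row_free => v vA0.
  by apply: (row_free_inj fA); rewrite mulmxA vA0 !mul0mx.
apply: (row_free_inj fA); rewrite mul0mx; apply/eqP.
by rewrite -dotmx_eq0 trmx_mul mulmxA -(mulmxA v) vA0 mul0mx mxE.
Qed.

Lemma gram_det_neq0 m n (A : 'M[R]_(m, n)) :
  (\det (A *m A^T) != 0) = row_free A.
Proof. by rewrite -gram_unitmx unitmxE unitfE. Qed.

(** The orthogonal projection onto the complement of the row space of A. *)
Definition orthoproj m n (A : 'M[R]_(m, n)) : 'M[R]_n :=
  1%:M - A^T *m invmx (A *m A^T) *m A.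

Lemma orthoproj_gram m n (A : 'M[R]_(m, n)) : row_free A ->
  orthoproj A *m (orthoproj A)^T = orthoproj A.
Proof.
rewrite -gram_unitmx => uG; rewrite /orthoproj.
set P := A^T *m _ *m A.
have PT : P^T = P.
  by rewrite !trmx_mul trmxK trmx_inv trmx_mul trmxK mulmxA.
have PP : P *m P = P.
  by rewrite /P -!mulmxA (mulmxA A A^T) mulKmx.
rewrite linearB /= trmx1 PT mulmxBr mulmx1 mulmxBl mul1mx PP.
by rewrite subrr subr0.
Qed.

Lemma mul_orthoproj_eq0 m n (A : 'M[R]_(m, n)) (u : 'rV[R]_n) :
  u *m orthoproj A = 0 -> (u <= A)%MS.
Proof.
rewrite mulmxBr mulmx1 => /subr0_eq ->.
by rewrite mulmxA submxMl.
Qed.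

(** The squared volume is that of the base times the squared distance to the
    base. *)
Lemma gram_det_col m n (u : 'rV[R]_n) (A : 'M[R]_(m, n)) : row_free A ->
  \det (col_mx u A *m (col_mx u A)^T) =
  \det (A *m A^T) * (u *m orthoproj A *m u^T) 0 0.
Proof.
rewrite -gram_unitmx => uG; rewrite tr_col_mx mul_col_row det_schur //.
by congr (_ * _ 0 0); rewrite mulmxBr mulmx1 mulmxBl !mulmxA.
Qed.

(** Induction on the number of rows through [gram_det_col]; when the lower rows
    are dependent, so are all of them. *)
Lemma gram_det_ge0 m n (A : 'M[R]_(m, n)) : 0 <= \det (A *m A^T).
Proof.
elim: m A => [|m IHm] A; first by rewrite det_mx00.
rewrite -[A](@vsubmxK _ 1 m).
move: (@usubmx _ 1 m _ A) (@dsubmx _ 1 m _ A) => u B.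
have [fB|nfB] := boolP (row_free B).
  rewrite gram_det_col // mulr_ge0 // -orthoproj_gram // mulmxA.
  by rewrite -mulmxA -trmx_mul dotmx_ge0.
rewrite [X in 0 <= X](_ : _ = 0) //; apply/eqP; apply: contraNT nfB.
rewrite gram_det_neq0 => fC; apply: inj_row_free => v vB0.
have v0 : row_mx (0 : 'rV_1) v *m col_mx u B = 0.
  by rewrite mul_row_col mul0mx vB0 add0r.
have : row_mx (0 : 'rV_1) v = 0.
  by apply: (row_free_inj fC); rewrite mul0mx.
by rewrite -row_mx0 => /eq_row_mx[].
Qed.

End GramMatrix.

(** * Cayley-Menger determinants *)

Section CayleyMenger.
Context {K : numFieldType} {d : nat}.

(** With x_i = v_i - v_0 one has |v_i - v_j|^2 = |x_i|^2 + |x_j|^2 - 2 x_i.x_j.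
    Subtracting multiples of the border row and column (the matrix L) removes
    the squared norms and leaves - 2 X X^T, whose first row and column vanish;
    a further row operation S makes the bordered matrix block triangular. *)
Lemma cayley_menger_gram k : exists2 c : K, c != 0 &
  forall v : 'I_k.+1 -> 'rV[K]_d,
    let W : 'M_(k, d) := \matrix_(i < k) (v (lift ord0 i) - v ord0) in
    cayley_menger v = c * \det (W *m W^T).
Proof.
pose S : 'M[K]_(1 + (1 + k)) :=
  block_mx 0 (row_mx 1%:M 0) (col_mx 1%:M 0)
           (block_mx 0 0 (const_mx (-1)) 1%:M).
pose S' : 'M[K]_(1 + (1 + k)) :=
  block_mx 0 (row_mx 1%:M 0) (col_mx 1%:M (const_mx 1))
           (block_mx 0 0 0 1%:M).
have SS' : S *m S' = 1%:M.
  rewrite mulmx_block !mul0mx mul_row_col mul_row_block mul_col_row mulmx_block.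
  rewrite (@mul_block_col _ 1 k 1 k 1) !mul0mx !mulmx0 !mul1mx !mulmx1.
  rewrite ?(addr0, add0r) add_block_mx ?(addr0, add0r) -!scalar_mx_block.
  rewrite row_mx0 (_ : const_mx (-1) + const_mx 1 = 0) ?col_mx0
          -?scalar_mx_block //.
  by apply/matrixP => i j; rewrite !mxE addNr.
exists (\det S' * (- 2) ^+ k).
  rewrite mulf_neq0 ?expf_neq0 ?oppr_eq0 ?pnatr_eq0 //.
  have /(congr1 determinant) := SS'; rewrite det_mulmx det1 => h.
  by apply: contra_eq_neq h => ->; rewrite mulr0 eq_sym oner_eq0.
move=> v W.
pose X : 'M[K]_(1 + k, d) := col_mx 0 W.
pose r : 'cV[K]_(1 + k) := \col_i (X *m X^T) i i.
pose D : 'M[K]_(1 + k) := \matrix_(i, j) sqdist (v i) (v j).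
have XE a : row a X = v a - v ord0 :> 'rV_d.
  rewrite -(fintype.splitK a); case: (fintype.split a) => j /=.
    by rewrite rowKu row0 ord1 lshift0 subrr.
  by rewrite rowKd rowK rshift1.
have DE : D = r *m const_mx 1 + const_mx 1 *m r^T - 2 *: (X *m X^T).
  have XEm l m : X l m = v l 0 m - v ord0 0 m.
    by have := congr1 (fun w : 'rV_d => w 0 m) (XE l); rewrite !mxE.
  have XXE a b : (X *m X^T) a b =
      \sum_m (v a 0 m - v ord0 0 m) * (v b 0 m - v ord0 0 m).
    by rewrite mxE; apply: eq_bigr => m _; rewrite [X^T _ _]mxE !XEm.
  have rE l : r l 0 = (X *m X^T) l l by rewrite mxE.
  move: (X *m X^T) r rE XXE => XX r' rE XXE.
  apply/matrixP => a b; rewrite !mxE !big_ord1 !mxE !rE !XXE !mulr1 !mul1r.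
  rewrite mulr_sumr -big_split -sumrB; apply: eq_bigr => m _ /=.
  by ring.
pose L : 'M[K]_(1 + (1 + k)) := block_mx 1%:M 0 (- r) 1%:M.
have detL : \det L = 1 by rewrite det_lblock !det1 mulr1.
have -> : cayley_menger v =
    \det (L *m block_mx 0 (const_mx 1) (const_mx 1) D *m L^T).
  by rewrite !det_mulmx det_tr detL mul1r mulr1.
have -> : L *m block_mx 0 (const_mx 1) (const_mx 1) D *m L^T =
  block_mx 0 (const_mx 1) (const_mx 1) (- 2 *: (X *m X^T)).
  rewrite tr_block_mx !mulmx_block.
  rewrite ?(mul0mx, mulmx0, mul1mx, mulmx1, add0r, addr0, trmx0, trmx1).
  apply: (congr1 (block_mx 0 (const_mx 1) (const_mx 1))); 
  rewrite DE linearN /= mulmxN mulNmx -!addrA !addKr.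
  by rewrite scaleNr.
set B : 'M[K]_(1 + (1 + k)) := block_mx 0 _ _ _.
have <- : \det S' * \det (S *m B) = \det B.
  by rewrite det_mulmx mulrA -det_mulmx (mulmx1C SS') det1 mul1r.
have XXE : X *m X^T = block_mx 0 0 0 (W *m W^T).
  by rewrite tr_col_mx mul_col_row trmx0 !mulmx0 !mul0mx.
have -> : S *m B =
    block_mx 1%:M 0 0 (block_mx 1%:M (const_mx 1) 0 (- 2 *: (W *m W^T))).
  rewrite /B XXE scale_block_mx !scaler0.
  have -> : const_mx 1 = row_mx 1%:M (const_mx 1) :> 'M[K]_(1, 1 + k).
    by rewrite -row_mx_const; congr (row_mx _ _); apply/matrixP => a b;
       rewrite !ord1 !mxE.
  have -> : const_mx 1 = col_mx 1%:M (const_mx 1) :> 'M[K]_(1 + k, 1).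
    by rewrite -col_mx_const; congr (col_mx _ _); apply/matrixP => a b;
       rewrite !ord1 !mxE.
  rewrite mulmx_block !mul0mx mul_row_col mul_row_block mul_col_row mulmx_block.
  rewrite (@mul_block_col _ 1 k 1 k 1) !mul0mx !mulmx0 !mul1mx !mulmx1.
  rewrite ?(addr0, add0r) add_block_mx ?(addr0, add0r).
  rewrite row_mx0 (_ : const_mx (-1) + const_mx 1 = 0) ?col_mx0 //.
  by apply/matrixP => a b; rewrite !mxE addNr.
rewrite det_ublock det1 mul1r det_ublock det1 mul1r detZ mulrA.
by [].
Qed.
End CayleyMenger.



(** Permuting the points conjugates the bordered matrix by a permutation
    matrix that fixes the border. *)
Lemma cayley_menger_perm (K : comNzRingType) d n (v : 'I_n -> 'rV[K]_d)
    (p : 'S_n) : cayley_menger (v \o p) = cayley_menger v.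
Proof.
pose P : 'M[K]_n := perm_mx p.
pose D : 'M[K]_n := \matrix_(i, j) sqdist (v i) (v j).
pose L : 'M[K]_(1 + n) := block_mx 1%:M 0 0 P.
have PT1 : P *m const_mx 1 = const_mx 1 :> 'cV_n.
  by rewrite -row_permE; apply/matrixP => i j; rewrite !mxE.
have PPT : P *m P^T = 1%:M by rewrite tr_perm_mx -perm_mxM mulgV perm_mx1.
have LLT : L *m L^T = 1%:M.
  rewrite tr_block_mx !trmx0 trmx1 mulmx_block !mul0mx !mulmx0 mulmx1 !addr0.
  by rewrite add0r PPT -scalar_mx_block.
rewrite /cayley_menger -/D.
set B : 'M[K]_(1 + n) := block_mx 0 _ _ D.
rewrite [RHS](_ : _ = \det (L *m B *m L^T)); last first.
  by rewrite !det_mulmx mulrAC -det_mulmx LLT det1 mul1r.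
congr determinant; rewrite tr_block_mx !mulmx_block !trmx0 trmx1.
rewrite ?(mul0mx, mulmx0, mulmx1, mul1mx, addr0, add0r) PT1.
congr block_mx.
  by rewrite -[RHS]trmxK trmx_mul trmxK trmx_const PT1 trmx_const.
rewrite tr_perm_mx -col_permE -row_permE.
by apply/matrixP => i j; rewrite !mxE.
Qed.

Lemma cayley_menger_map (K L : comNzRingType) (f : {rmorphism K -> L}) d n
    (v : 'I_n -> 'rV[K]_d) :
  cayley_menger (fun i => map_mx f (v i)) = f (cayley_menger v).
Proof.
rewrite /cayley_menger -det_map_mx map_block_mx map_mx0 !map_const_mx rmorph1.
congr (\det (block_mx _ _ _ _)); apply/matrixP => i j; rewrite !mxE rmorph_sum.
by apply: eq_bigr => k _; rewrite !mxE rmorphXn rmorphB.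
Qed.

(** * The Gram determinant of a list of points *)

Section Gram.
Context {R : realType} {d : nat}.
Implicit Types (s t l : seq 'rV[R]_d) (x y z : 'rV[R]_d).

Definition gram s : R := \det (edge_mx s *m (edge_mx s)^T).

Lemma gram_ge0 s : 0 <= gram s.
Proof. exact: gram_det_ge0. Qed.

Lemma gram1 x : gram [:: x] = 1.
Proof. exact: det_mx00. Qed.

Lemma cayley_menger_seq k : exists2 c : R, c != 0 &
  forall s, size s = k.+1 ->
    cayley_menger (fun i : 'I_k.+1 => s`_i) = c * gram s.
Proof.
have [c c0 h] := @cayley_menger_gram R d k; exists c => //.
by case=> // x l [?]; subst k; rewrite h.
Qed.

(** The definition singles out the first point as the origin; symmetry is read
    off from the Cayley-Menger form. *)
Lemma gram_perm s t : perm_eq s t -> gram s = gram t.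
Proof.
move=> st; have szst := perm_size st.
case: t st szst => [|x l] st szst; first by rewrite (size0nil szst).
have [c c0 h] := cayley_menger_seq (size l).
apply: (mulfI c0); rewrite -!h //.
have /tuple_permP[p /= sE] : perm_eq s (in_tuple (x :: l)) by [].
rewrite -[RHS](@cayley_menger_perm _ _ _ _ p); congr cayley_menger.
apply: funext => i /=; rewrite sE (nth_map i) ?size_enum_ord // nth_ord_enum.
by rewrite (tnth_nth 0).
Qed.

Lemma edge_mx_cons2 x z l :
  edge_mx [:: x, z & l] =
  col_mx (z - x) (edge_mx (x :: l)) :> 'M_(1 + size l, d).
Proof.
apply/(@row_matrixP _ (1 + size l) d) => i; case: (@split_ordP 1 _ i) => j ->.
  by rewrite rowKu ord1; apply/rowP => k; rewrite !mxE.
by rewrite rowKd; apply/rowP => k; rewrite !mxE.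
Qed.

Lemma gram_neq0 s : (gram s != 0) = row_free (edge_mx s).
Proof. exact: gram_det_neq0. Qed.

Lemma gram_cons2 x z l : gram (x :: l) != 0 ->
  gram [:: x, z & l] = gram (x :: l) *
    ((z - x) *m orthoproj (edge_mx (x :: l)) *m (z - x)^T) 0 0.
Proof. by rewrite gram_neq0 /gram edge_mx_cons2 => /gram_det_col->. Qed.

Lemma gram_dup x l : gram (x :: l) != 0 -> gram [:: x, x & l] = 0.
Proof. by move=> /gram_cons2->; rewrite subrr !mul0mx mxE mulr0. Qed.

Lemma gram_cons2_eq0 x z l : gram (x :: l) != 0 -> gram [:: x, z & l] = 0 ->
  (z - x <= edge_mx (x :: l))%MS.
Proof.
move=> g0; rewrite gram_cons2 // => /eqP; rewrite mulf_eq0 (negPf g0) /=.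
rewrite gram_neq0 in g0; rewrite -{1}orthoproj_gram //.
rewrite mulmxA -mulmxA -trmx_mul dotmx_eq0 => /eqP.
exact: mul_orthoproj_eq0.
Qed.

(** This bounds the number of affinely independent points in a flat. *)
Lemma gram_neq0_rank m (A : 'M[R]_(m, d)) x s : gram s != 0 ->
  (forall z, z \in s -> (z - x <= A)%MS) -> (size s <= (\rank A).+1)%N.
Proof.
rewrite gram_neq0 => /eqP rs sA; rewrite -[X in (_ <= X.+1)%N]/(\rank A).
suff /mxrankS : (edge_mx s <= A)%MS by rewrite rs; case: (size s).
apply/row_subP => i; rewrite rowK.
have lt : (i.+1 < size s)%N by rewrite -ltn_predRL.
have -> : s`_i.+1 - s`_0 = (s`_i.+1 - x) - (s`_0 - x).
  by rewrite opprB addrA subrK.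
by rewrite addmx_sub ?eqmx_opp ?sA ?mem_nth // (leq_ltn_trans _ lt).
Qed.

End Gram.



(** * Gram determinants as quadratic functions of one point *)

Section Rank.
Context {R : realType} {d : nat}.
Implicit Types (s t l : seq 'rV[R]_d) (x y z : 'rV[R]_d).

(** The monomials of degree at most 2 in the coordinates of z, so that every
    quadratic function of z is a linear function of [veronese z]. *)
Definition veronese z : 'rV[R]_((1 + d) * (1 + d)) :=
  mxvec ((row_mx (1%:M : 'M_1) z)^T *m row_mx 1%:M z).

Lemma gram_veronese x l : gram (x :: l) != 0 ->
  exists T : 'rV[R]_((1 + d) * (1 + d)),
    forall z, gram [:: x, z & l] = (veronese z *m T^T) 0 0.
Proof.
move=> g0; pose K : 'M[R]_(1 + d, d) := col_mx (- x) 1%:M.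
exists (mxvec (gram (x :: l) *:
               (K *m orthoproj (edge_mx (x :: l)) *m K^T))) => z.
rewrite mxvec_dotmul -scalemxAr -scalemxAl [in RHS]mxE gram_cons2 //.
have -> : z - x = row_mx 1%:M z *m K by rewrite mul_row_col mul1mx mulmx1 addrC.
by rewrite trmx_mul !mulmxA.
Qed.

(** The matrix of differences
    gram (x i, x j, l i) - gram (x i, y j, l i) factors through the space of
    monomials of degree at most 2, so its rank is less than its size; yet it
    would be diagonal, with diagonal - gram (x i, y i, l i). *)
Lemma no_gram_family (N : nat) (x y : 'I_N -> 'rV[R]_d)
    (l : 'I_N -> seq 'rV[R]_d) :
  ((1 + d) * (1 + d) < N)%N ->
  (forall i, gram (x i :: l i) != 0) ->
  (forall i, gram [:: x i, y i & l i] != 0) ->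
  ~ (forall i j, i != j ->
      gram [:: x i, x j & l i] = gram [:: x i, y j & l i]).
Proof.
move=> ltN g0 gy gxy.
have [T TE] := choice (fun i => gram_veronese (g0 i)).
pose P := \matrix_j (veronese (x j) - veronese (y j)).
pose M := P *m (\matrix_i T i)^T.
have ME j i : M j i = gram [:: x i, x j & l i] - gram [:: x i, y j & l i].
  rewrite !TE.
  have -> : M j i = ((veronese (x j) - veronese (y j)) *m (T i)^T) 0 0.
    by rewrite !mxE; apply: eq_bigr => k _; rewrite !mxE.
  by rewrite mulmxBl !mxE.
have Mdiag : M = diag_mx (\row_i M i i).
  apply/matrixP => j i; rewrite [RHS]mxE [in RHS]mxE.
  case: eqVneq => [->|ji]; first by rewrite mulr1n.
  by rewrite mulr0n ME gxy 1?eq_sym // subrr.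
have : M \in unitmx.
  rewrite unitmxE unitfE Mdiag det_diag; apply/prodf_neq0 => i _.
  by rewrite mxE ME gram_dup // sub0r oppr_eq0.
move/mxrank_unit => rM; have : (N <= (1 + d) * (1 + d))%N.
  by rewrite -rM (leq_trans (mxrankM_maxl _ _)) // rank_leq_col.
by rewrite leqNgt ltN.
Qed.

Lemma edge_vspace x l : gram (x :: l) != 0 ->
  exists2 W : {vspace 'rV[R]_d}, \dim W = size l &
    forall z : 'rV[R]_d, (z <= edge_mx (x :: l))%MS -> z \in W.
Proof.
rewrite gram_neq0 => fE; pose A := edge_mx (x :: l).
pose e := [tuple row i A | i < size l].
have comb (v : 'rV_(size l)) : v *m A = \sum_i v 0 i *: e`_i.
  rewrite mulmx_sum_row; apply: eq_bigr => i _; congr (_ *: _).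
  by rewrite (nth_map i) ?size_enum_ord // nth_ord_enum.
have fe : free e.
  apply/freeP => k k0 i.
  have : \row_i k i = 0.
    apply: (row_free_inj fE); rewrite mul0mx comb -[RHS]k0.
    by apply: eq_bigr => j _; rewrite mxE.
  by move/rowP/(_ i); rewrite !mxE.
exists <<e>>%VS; first by rewrite (eqnP fe) size_tuple.
move=> z /submxP[v ->]; rewrite comb; apply: rpred_sum => i _.
by rewrite rpredZ // memv_span // mem_nth // size_tuple.
Qed.

End Rank.

(** * Indiscernibility in terms of Gram determinants *)

Section Indiscernible.
Context {R : realType} {d : nat}.
Implicit Types (s t l A B : seq 'rV[R]_d) (x y z : 'rV[R]_d).

Lemma to_complex_inj : injective (@to_complex R d).
Proof. by apply: map_mx_inj => a b []. Qed.

Lemma rel_to_complexE (E : 'rV[R]_d -> 'rV[R]_d -> Prop) x y :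
  rel_to_complex E (to_complex x) (to_complex y) <-> E x y.
Proof.
split=> [[x' [y' [/to_complex_inj-> /to_complex_inj->]]]//|xy].
by exists x, y.
Qed.

Lemma cayley_menger_to_complex n (v : 'I_n -> 'rV[R]_d) :
  cayley_menger (fun i => to_complex (v i)) = real_complex R (cayley_menger v).
Proof. exact: cayley_menger_map. Qed.

(** The pair formula says that the two determinants agree up to sign, and a
    Gram determinant is determined by its absolute value. *)
Lemma gram_indiscernible (X : set 'rV[R]_d) (E : 'rV[R]_d -> 'rV[R]_d -> Prop) :
  Delta_indiscernible (to_complex @` X) (rel_to_complex E) ->
  forall s (f : 'rV[R]_d -> 'rV[R]_d),
  uniq s -> uniq (map f s) -> {in s, forall x, X x /\ X (f x)} ->
  {in s &, forall x y, E x y <-> E (f x) (f y)} ->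
  forall A B b, (2 <= b <= d.+1)%N -> size A = b -> size B = b ->
  {subset A <= s} -> {subset B <= s} ->
  (gram A = 0 <-> gram (map f A) = 0) /\
  (gram A = gram B <-> gram (map f A) = gram (map f B)).
Proof.
move=> hind s f us ufs sX fE A B b b2 szA szB As Bs.
pose x (i : 'I_(size s)) : 'rV[R[i]]_d := to_complex s`_i.
pose y (i : 'I_(size s)) : 'rV[R[i]]_d := to_complex (f s`_i).
have sP (i : 'I_(size s)) : s`_i \in s by rewrite mem_nth.
have xinj : injective x.
  move=> i j /to_complex_inj/eqP; rewrite nth_uniq // => /eqP ij.
  exact: val_inj.
have yinj : injective y.
  move=> i j /to_complex_inj/eqP.
  rewrite -!(nth_map 0 0 f) // nth_uniq ?size_map // => /eqP ij.
  exact: val_inj.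
have xX i : (to_complex @` X) (x i) by exists s`_i => //; case: (sX _ (sP i)).
have yX i : (to_complex @` X) (y i).
  by exists (f s`_i) => //; case: (sX _ (sP i)).
have xyE (i j : 'I_(size s)) : (i < j)%N ->
    (rel_to_complex E (x i) (x j) <-> rel_to_complex E (y i) (y j)).
  by move=> _; rewrite !rel_to_complexE; apply: fE.
have idx C : size C = b -> {subset C <= s} ->
    exists I : 'I_b -> 'I_(size s), forall k : 'I_b, s`_(I k) = C`_k.
  move=> szC Cs; have Cks (k : 'I_b) : C`_k \in s by rewrite Cs // mem_nth ?szC.
  have lt (k : 'I_b) : (index (C`_k)%R s < size s)%N by rewrite index_mem.
  by exists (fun k => Ordinal (lt k)) => k /=; rewrite nth_index.
have [I IE] := idx A szA As; have [J JE] := idx B szB Bs.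
have [/(_ I) h1 /(_ I J) h2] := hind _ x y xinj yinj xX yX xyE b b2.
case: b b2 szA szB I IE J JE idx h1 h2 => // k b2 szA szB I IE J JE _ h1 h2.
have [c c0 hc] := @cayley_menger_seq R d k.
have cx C (L : 'I_k.+1 -> 'I_(size s)) : size C = k.+1 ->
    (forall k : 'I_k.+1, s`_(L k) = C`_k) ->
    cayley_menger (x \o L) = real_complex R (c * gram C).
  move=> szC LE; rewrite -hc // -cayley_menger_to_complex.
  by congr cayley_menger; apply: funext => m /=; rewrite /x LE.
have cy C (L : 'I_k.+1 -> 'I_(size s)) : size C = k.+1 ->
    (forall k : 'I_k.+1, s`_(L k) = C`_k) ->
    cayley_menger (y \o L) = real_complex R (c * gram (map f C)).
  move=> szC LE; rewrite -hc ?size_map // -cayley_menger_to_complex.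
  congr cayley_menger; apply: funext => m /=.
  by rewrite /y LE (nth_map 0) // szC.
have rc0 (r : R) : real_complex R r = 0 <-> r = 0.
  by split=> [[]//|->].
have cg0 C : c * gram C = 0 <-> gram C = 0.
  by split=> [/eqP|->]; rewrite ?mulr0 // mulf_eq0 (negPf c0) => /eqP.
have pair0 C D : real_complex R (c * gram C) = - real_complex R (c * gram D) \/
  real_complex R (c * gram C) = real_complex R (c * gram D) <-> gram C = gram D.
  split=> [|->]; last by right.
  case=> [|[]/(mulfI c0)//]; rewrite -rmorphN => -[].
  rewrite -mulrN => /(mulfI c0) CD.
  have := gram_ge0 C; have := gram_ge0 D.
  by move=> ? ?; lra.
split.
  by move: h1; rewrite (cx A) // (cy A) // !rc0 !cg0.
have cmp0 (u v : R[i]) : (u - v) * (u + v) = 0 <-> (u = - v \/ u = v).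
  split=> [/eqP|].
    by rewrite mulf_eq0 subr_eq0 addr_eq0 => /orP[]/eqP; tauto.
  by case=> ->; rewrite ?addNr ?subrr ?mulr0 ?mul0r.
move: h2; rewrite /cm_pair (cx A) // (cy A) // (cx B) // (cy B) //.
by rewrite !cmp0 !pair0.
Qed.

End Indiscernible.

(** * Flats and volumes *)

Lemma mem_edge_mx (R : realType) d (x : 'rV[R]_d) l z : gram (x :: l) != 0 ->
  z \in x :: l -> (z - x <= edge_mx (x :: l))%MS.
Proof.
move=> g0 zl; apply: gram_cons2_eq0 => //.
have pz := perm_to_rem zl.
rewrite -[LHS](@gram_perm _ _ [:: z, z & rem z (x :: l)]).
  by apply: gram_dup; rewrite -(gram_perm pz).
by rewrite perm_sym (perm_catCA [:: x] [:: z]) perm_cons.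
Qed.

Lemma gram_size_le (R : realType) d (s : seq 'rV[R]_d) :
  gram s != 0 -> (size s <= d.+1)%N.
Proof.
move=> g0; have := gram_neq0_rank (A := 1%:M) (x := 0) g0.
by rewrite mxrank1; apply=> z _; apply: submx1.
Qed.

Lemma volume_neq0 (R : realType) d (A : {fset 'rV[R]_d}) :
  gram (enum_fset A) != 0 -> volume A <> 0.
Proof.
move=> g0; apply/eqP.
rewrite mulf_neq0 ?invr_eq0 ?pnatr_eq0 -?lt0n ?fact_gt0 //.
by rewrite gt_eqF // sqrtr_gt0 lt_def g0 gram_ge0.
Qed.

Lemma volume_inj (R : realType) d (A B : {fset 'rV[R]_d}) : #|` A| = #|` B| ->
  volume A = volume B -> gram (enum_fset A) = gram (enum_fset B).
Proof.
move=> AB; rewrite /volume /simplex_volume -!/(gram _) AB => /mulIf.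
rewrite invr_eq0 pnatr_eq0 -lt0n fact_gt0 => /(_ isT) /eqP.
by rewrite eqr_sqrt ?gram_ge0 // => /eqP.
Qed.

Lemma strongly_rainbow_subset (R : realType) d b (Y Z : set 'rV[R]_d) :
  Y `<=` Z -> strongly_rainbow b Z -> strongly_rainbow b Y.
Proof.
move=> YZ [Z0 Zinj]; split=> [A AY|A B AY BY].
  by apply: Z0; apply: subset_trans YZ.
by apply: Zinj; [apply: subset_trans YZ|apply: subset_trans YZ].
Qed.

(** * Fresh points and fresh classes *)

Lemma infinite_notin (T : choiceType) (C : set T) (s : seq T) :
  infinite_set C -> exists2 y, C y & y \notin s.
Proof.
move=> Cinf; apply: contrapT => /forall2NP h; apply: Cinf.
apply: (sub_finite_set _ (finite_seq s)) => y Cy /=.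
by have [//|/negP] := h y; rewrite negbK.
Qed.

Section Combinatorics.
Context {R : realType} {d : nat}.
Context (X : set 'rV[R]_d) (E : 'rV[R]_d -> 'rV[R]_d -> Prop).
Context (hE : equivalence_on X E).
Context (hclasses : infinite_set (eclasses X E)).
Context (hclass : forall C, eclasses X E C -> infinite_set C).
Context (hind : Delta_indiscernible (to_complex @` X) (rel_to_complex E)).
Implicit Types (s t l u A B : seq 'rV[R]_d) (x y z p q r : 'rV[R]_d).

Let Erefl x : X x -> E x x. Proof. by case: hE => h _ _; apply: h. Qed.
Let Esym x y : E x y -> X x -> X y -> E y x.
Proof. by case: hE => _ h _ *; apply: h. Qed.
Let Etrans x y z : E x y -> E y z -> X x -> X y -> X z -> E x z.
Proof. by case: hE => _ _ h *; apply: (h x y z). Qed.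

Lemma fresh_in_class x s : X x -> exists y, [/\ X y, E x y & y \notin s].
Proof.
move=> Xx; have Cinf : infinite_set (eclass X E x) by apply: hclass; exists x.
by have [y [Xy xy] ys] := infinite_notin s Cinf; exists y.
Qed.

Definition class_seq x t := uniq t /\ {in t, forall y, X y /\ E x y}.

Lemma fresh_class_seq x s n : X x ->
  exists t, [/\ size t = n, class_seq x t & {in t, forall y, y \notin s}].
Proof.
move=> Xx; elim: n s => [|n IHn] s; first by exists [::]; split.
have [y [Xy xy ys]] := fresh_in_class s Xx.
have [t [szt [ut tX] ts]] := IHn (y :: s).
exists (y :: t); split; first by rewrite /= szt.
  split=> [|z]; last by rewrite inE => /predU1P[->//|/tX].
  by rewrite /= ut andbT; apply/negP => /ts; rewrite mem_head.
by move=> z; rewrite inE => /predU1P[->//|/ts]; rewrite inE negb_or => /andP[].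
Qed.

Lemma fresh_class s : {in s, forall x, X x} ->
  exists2 y, X y & {in s, forall x, ~ E x y}.
Proof.
move=> sX; apply: contrapT => /forall2NP h; apply: hclasses.
apply: (sub_finite_set _ (finite_image (eclass X E) (finite_seq s))).
move=> _ [y Xy <-]; have [//|/existsNP[x /not_implyP[xs /contrapT xy]]] := h y.
exists x => //; have Xx := sX _ xs.
apply/seteqP; split=> z [Xz ez]; split=> //; last by apply: Etrans xy ez _ _ _.
by apply: Etrans (Esym xy _ _) ez _ _ _.
Qed.

Lemma fresh_classes s n : {in s, forall x, X x} ->
  exists c : nat -> 'rV[R]_d, forall i, (i < n)%N -> [/\ X (c i),
    {in s, forall x, ~ E x (c i)} & forall j, (j < i)%N -> ~ E (c j) (c i)].
Proof.
move=> sX; elim: n => [|n [c cP]]; first by exists (fun=> 0).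
have [x|y Xy ys] := @fresh_class (s ++ mkseq c n).
  rewrite mem_cat => /orP[/sX//|/mapP[k]].
  by rewrite mem_iota => /cP[Xc _ _] ->.
exists (fun i => if i == n then y else c i) => i.
rewrite ltnS leq_eqVlt; case: eqVneq => [-> _|_ /= lin]; last first.
  have [Xc sc cc] := cP _ lin; split=> // j ji.
  by rewrite ltn_eqF ?(ltn_trans ji) //; apply: cc.
split=> // [x xs|j ji]; first by apply: ys; rewrite mem_cat xs.
rewrite ltn_eqF //; apply: ys; rewrite mem_cat; apply/orP; right.
by apply/mapP; exists j; rewrite // mem_iota.
Qed.

Lemma map_subst z z' l : z \notin l ->
  [seq if x == z then z' else x | x <- l] = l.
Proof.
move=> zl; rewrite -[RHS]map_id; apply/eq_in_map => x xl.
by case: eqVneq zl => // <-; rewrite xl.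
Qed.

(** The basic use of indiscernibility: a point may be replaced by a fresh point
    of its class. *)
Lemma gram_subst z z' t A B b : let f x := if x == z then z' else x in
  uniq t -> z \notin t -> z' \notin t -> {in t, forall x, X x} ->
  X z -> X z' -> E z z' -> (2 <= b <= d.+1)%N -> size A = b -> size B = b ->
  {subset A <= z :: t} -> {subset B <= z :: t} ->
  (gram A = 0 <-> gram (map f A) = 0) /\
  (gram A = gram B <-> gram (map f A) = gram (map f B)).
Proof.
move=> f ut zt z't tX Xz Xz' zz' b2 szA szB As Bs.
have Ez : {in z :: t, forall x, X x /\ X (f x)}.
  by move=> x; rewrite inE /f; case: eqVneq => [->|_ /= /tX].
have Ef : {in z :: t, forall x, E x (f x)}.
  move=> x /Ez[Xx _]; rewrite /f; case: eqVneq => [->//|_]; exact: Erefl.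
apply: (gram_indiscernible hind (s := z :: t)) b2 szA szB As Bs => //.
- by rewrite /= zt.
- by rewrite /= map_subst // ut /f eqxx z't.
- move=> x y xs ys; have [Xx Xfx] := Ez _ xs; have [Xy Xfy] := Ez _ ys.
  have xfx := Ef _ xs; have yfy := Ef _ ys; split=> h.
    by apply: Etrans (Esym xfx _ _) (Etrans h yfy _ _ _) _ _ _.
  by apply: Etrans xfx (Etrans h (Esym yfy _ _) _ _ _) _ _ _.
Qed.

(** * Volumes of subsets of X *)

Section IndependentClass.
Context (a : nat) (a2 : (2 <= a <= d.+1)%N) (x0 : 'rV[R]_d) (t0 : seq 'rV[R]_d).
Context (Xx0 : X x0) (t0C : class_seq x0 t0) (szt0 : size t0 = a).
Context (gt0 : gram t0 != 0).

(** All lists of distinct points in one class have the same E-pattern. *)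
Lemma gram_class_neq0 x t : X x -> class_seq x t -> size t = a -> gram t != 0.
Proof.
move=> Xx [ut tC] szt; have [ut0 t0X] := t0C.
pose f y := t`_(seq.index y t0).
have ft : map f t0 = t.
  apply: (@eq_from_nth _ 0); rewrite ?size_map ?szt // szt0 => i lti.
  by rewrite (nth_map 0) ?szt0 // /f index_uniq // szt0.
have fC : {in t0, forall y, X (f y) /\ E x (f y)}.
  by move=> y yt0; apply: tC; rewrite mem_nth // szt -szt0 index_mem.
have [] := @gram_indiscernible _ _ _ _ hind t0 f ut0 _ _ _ t0 t0 a a2 szt0 szt0.
- by rewrite ft.
- by move=> y yt0; have [] := t0X _ yt0; have [] := fC _ yt0.
- move=> y z yt0 zt0; have [Xy xy] := t0X _ yt0; have [Xz xz] := t0X _ zt0.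
  have [Xfy xfy] := fC _ yt0; have [Xfz xfz] := fC _ zt0.
  by split=> _; [apply: Etrans (Esym xfy _ _) xfz _ _ _|
                  apply: Etrans (Esym xy _ _) xz _ _ _].
- by [].
- by [].
by rewrite ft => h _; apply/eqP => /h; apply/eqP.
Qed.

(** If x, z and l are dependent but x and l are not, all fresh points in the
    class of z lie in the flat of x and l, whose dimension is too small to
    contain a independent points. *)
Lemma gram_uniq_neq0 t : uniq t -> {in t, forall x, X x} ->
  (0 < size t <= a)%N -> gram t != 0.
Proof.
have [n] := ubnP (size t); elim: n t => // n IHn [|x [|z l]] //.
  by rewrite gram1 oner_eq0.
rewrite ltnS => szn ut tX /andP[_ sza].
have /and3P[/[!inE]/norP[xz xl] zl ul] := ut.
have Xx : X x by apply: tX; rewrite inE eqxx.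
have Xz : X z by apply: tX; rewrite !inE eqxx orbT.
have lX : {in l, forall y, X y}.
  by move=> y yl; apply: tX; rewrite !inE yl !orbT.
have g0 : gram (x :: l) != 0.
  apply: IHn => /=; rewrite ?xl ?(ltnW sza) //.
  by move=> y /[!inE]/predU1P[->|/lX].
apply/eqP => gz0.
have [u [szu uC ul']] := fresh_class_seq [:: x, z & l] a Xz.
have uA y : y \in u -> (y - x <= edge_mx (x :: l))%MS.
  move=> yu; apply: gram_cons2_eq0 => //.
  have /[!inE] /norP[yx /norP[yz yl]] := ul' _ yu.
  have [_ /(_ _ yu)[Xy zy]] := uC.
  have [] := @gram_subst z y (x :: l) [:: x, z & l] [:: x, z & l] (size l).+2.
  - by rewrite /= xl.
  - by rewrite inE negb_or eq_sym xz.
  - by rewrite inE negb_or yx.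
  - by move=> v /[!inE]/predU1P[->|/lX].
  - by [].
  - by [].
  - by [].
  - by case/andP: a2 => _; apply: leq_trans.
  - by [].
  - by [].
  - by move=> v /[!inE] /or3P[] ->; rewrite ?orbT.
  - by move=> v /[!inE] /or3P[] ->; rewrite ?orbT.
  by rewrite /= (negPf xz) eqxx map_subst // => -[/(_ gz0)].
have := gram_neq0_rank (gram_class_neq0 Xz uC szu) uA.
rewrite szu leqNgt => /negP[]; apply: leq_trans sza.
by rewrite !ltnS; apply: (rank_leq_row (edge_mx (x :: l))).
Qed.

Lemma gram_eq_subst z z' t A B : uniq (z :: t) -> z' \notin t ->
  {in t, forall x, X x} -> X z -> X z' -> E z z' ->
  (2 <= size A <= d.+1)%N -> size B = size A ->
  {subset A <= z :: t} -> {subset B <= z :: t} -> gram A = gram B ->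
  gram [seq if x == z then z' else x | x <- A] =
  gram [seq if x == z then z' else x | x <- B].
Proof.
move=> /=/andP[zt ut] z't tX Xz Xz' zz' szA szB As Bs AB.
by have [_ [/(_ AB)]] := gram_subst ut zt z't tX Xz Xz' zz' szA erefl szB As Bs.
Qed.

(** If the two were equal, then by indiscernibility r, p and p' could be
    replaced by any three distinct fresh points u_i, u_j, u_N of their class,
    and the lists u_i, l with the points u_N would contradict
    [no_gram_family]. *)
Lemma gram_neq_same_class r p p' l : uniq [:: r, p, p' & l] ->
  {in [:: r, p, p' & l], forall x, X x} -> E r p -> E p p' ->
  ((size l).+2 <= a)%N -> gram [:: r, p & l] <> gram [:: r, p' & l].
Proof.
move=> us sX rp pp' sza geq.
have sd : (2 <= (size l).+2 <= d.+1)%N.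
  by case/andP: a2 => _; apply: leq_trans.
have Xr : X r by apply: sX; rewrite inE eqxx.
have Xp : X p by apply: sX; rewrite !inE eqxx orbT.
have Xp' : X p' by apply: sX; rewrite !inE eqxx !orbT.
have lX : {in l, forall y, X y}.
  by move=> y yl; apply: sX; rewrite !inE yl !orbT.
pose N := ((1 + d) * (1 + d)).+1.
(* One more point than [no_gram_family] needs: the last one is the common y. *)
have [u [szu [uu uC] uF]] := fresh_class_seq [:: r, p, p' & l] N.+1 Xp.
have ul := us; rewrite /= !inE !negb_or in ul.
case/and4P: ul => /and3P[rp0 rp'0 rl] /andP[pp'0 pl] p'l ul.
(* These inclusions discharge side conditions of the substitutions below. *)
have sub3 v1 v2 v3 : {subset [:: v1, v2 & l] <= [:: v3, v1, v2 & l]}.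
  by move=> v vs; rewrite inE vs orbT.
have sub3' v1 v2 v3 : {subset [:: v1, v2 & l] <= [:: v2, v1, v3 & l]}.
  by move=> v; rewrite !inE => /or3P[] ->; rewrite ?orbT.
have sub3'' v1 v2 v3 : {subset [:: v1, v2 & l] <= [:: v1, v3, v2 & l]}.
  by move=> v; rewrite !inE => /or3P[] ->; rewrite ?orbT.
have key v1 v2 v3 : v1 \in u -> v2 \in u -> v3 \in u -> uniq [:: v1; v2; v3] ->
    gram [:: v1, v2 & l] = gram [:: v1, v3 & l].
  move=> v1u v2u v3u; rewrite /= !inE andbT negb_or.
  move=> /andP[/andP[v12 v13] v23].
  have := uF _ v1u; have := uF _ v2u; have := uF _ v3u.
  rewrite !inE !negb_or => /and4P[v3r v3p v3p' v3l] /and4P[v2r v2p v2p' v2l].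
  move=> /and4P[v1r v1p v1p' v1l].
  have [[Xv1 pv1] [Xv2 pv2] [Xv3 pv3]] := And3 (uC _ v1u) (uC _ v2u) (uC _ v3u).
  (* One point is replaced at a time: p' by v3, then p by v2, then r by v1. *)
  have g1 : gram [:: r, p & l] = gram [:: r, v3 & l].
    have := @gram_eq_subst p' v3 [:: r, p & l] [:: r, p & l] [:: r, p' & l].
    rewrite /= !(eqxx, inE, negb_or) (negPf rp'0) (negPf pp'0) map_subst //.
    apply=> //.
    - by rewrite ![p' == _]eq_sym rp'0 pp'0 p'l rp0 rl pl.
    - by rewrite v3r v3p.
    - by move=> y; rewrite !inE => /or3P[/eqP->|/eqP->|/lX].
    - exact: Etrans (Esym pp' _ _) pv3 _ _ _.
  have g2 : gram [:: r, v2 & l] = gram [:: r, v3 & l].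
    have := @gram_eq_subst p v2 [:: r, v3 & l] [:: r, p & l] [:: r, v3 & l].
    rewrite /= !(eqxx, inE, negb_or) (negPf rp0) (negPf v3p) map_subst //.
    apply=> //.
    - by rewrite ![p == _]eq_sym [r == v3]eq_sym rp0 v3p pl v3r rl v3l.
    - by rewrite v2r v23.
    - by move=> y; rewrite !inE => /or3P[/eqP->|/eqP->|/lX].
  have := @gram_eq_subst r v1 [:: v2, v3 & l] [:: r, v2 & l] [:: r, v3 & l].
  rewrite /= !(eqxx, inE, negb_or) (negPf v2r) (negPf v3r) map_subst //.
  apply=> //.
  - by rewrite ![r == _]eq_sym v2r v3r rl v23 v2l v3l.
  - by rewrite v12 v13.
  - by move=> y; rewrite !inE => /or3P[/eqP->|/eqP->|/lX].
  - exact: Etrans rp pv1 _ _ _.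
  - by move=> v; rewrite !inE => /or3P[] ->; rewrite ?orbT.
have uP i : (i < N.+1)%N -> u`_i \in u by move=> lti; rewrite mem_nth ?szu.
have uneq i j : (i < N.+1)%N -> (j < N.+1)%N -> (u`_i == u`_j) = (i == j).
  by move=> ? ?; rewrite nth_uniq ?szu.
have notl v : v \in u -> v \notin l.
  by move=> /uF; rewrite !inE !negb_or => /and4P[].
have iN (i : 'I_N) : (i < N.+1)%N by rewrite ltnW // ltnS.
apply: (@no_gram_family _ _ N (fun i => u`_i) (fun=> u`_N) (fun=> l)).
- exact: ltnSn.
- move=> i; apply: gram_uniq_neq0 => /=; last by rewrite ltnW.
    by rewrite notl ?uP.
  by move=> v /[!inE]/predU1P[->|/lX//]; have [] := uC _ (uP _ (iN i)).
- move=> i; apply: gram_uniq_neq0 => //=.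
    by rewrite inE !negb_or uneq // ltn_eqF // !notl ?uP.
  move=> v /[!inE]/or3P[/eqP->|/eqP->|/lX//].
    by have [] := uC _ (uP _ (iN i)).
  by have [] := uC _ (uP _ (ltnSn N)).
- move=> i j; rewrite -val_eqE /= => ij.
  apply: key; rewrite ?uP // /= !inE !uneq // andbT.
  by rewrite negb_or ij !ltn_eqF.
Qed.

(** Here p and p' lie in a class that x and l avoid.  Let g i move the points of
    x and l that are equivalent to x into a fresh class c i, and fix the others.
    The points g j x and a further point y j of the class c j are then to
    g i x and map (g i) l as p and p' are to x and l, for all j <> i. *)
Lemma gram_neq_other_class x p p' l : uniq [:: x, p, p' & l] ->
  {in [:: x, p, p' & l], forall y, X y} -> E p p' ->
  {in x :: l, forall y, ~ E y p} ->
  ((size l).+2 <= a)%N -> gram [:: x, p & l] <> gram [:: x, p' & l].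
Proof.
move=> us sX pp' sp sza geq.
have sd : (2 <= (size l).+2 <= d.+1)%N.
  by case/andP: a2 => _; apply: leq_trans.
have Xx : X x by apply: sX; rewrite inE eqxx.
have Xp : X p by apply: sX; rewrite !inE eqxx orbT.
have Xp' : X p' by apply: sX; rewrite !inE eqxx !orbT.
have xlX : {in x :: l, forall y, X y}.
  move=> y /[!inE] yl; apply: sX; rewrite !inE.
  by case/orP: yl => ->; rewrite ?orbT.
have ul := us; rewrite /= !inE !negb_or in ul.
case/and4P: ul => /and3P[rp0 rp'0 rl] /andP[pp'0 pl] p'l ul.
pose N := ((1 + d) * (1 + d)).+1.
have [c cP] := fresh_classes N sX.
have cX (i : 'I_N) : X (c i) by have [] := cP _ (ltn_ord i).
have cs (i : 'I_N) : {in [:: x, p, p' & l], forall y, ~ E y (c i)}.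
  by have [] := cP _ (ltn_ord i).
have cc (i j : 'I_N) : i != j -> ~ E (c i) (c j).
  rewrite -val_eqE neq_ltn => /orP[] ij.
    by have [_ _ /(_ _ ij)] := cP _ (ltn_ord j).
  by have [_ _ /(_ _ ij) h /Esym ji] := cP _ (ltn_ord i); apply/h/ji.
(* A class receives at most (size l).+1 points; the last entry of T i is the
   spare point y i. *)
have /choice[T TP] (i : 'I_N) := fresh_class_seq [::] (size l).+2 (cX i).
have Tin i k : (k < (size l).+2)%N -> X (T i)`_k /\ E (c i) (T i)`_k.
  by have [sz [_ h] _] := TP i => kl; apply: h; rewrite mem_nth // sz.
have Tuniq i k m : (k < (size l).+2)%N -> (m < (size l).+2)%N ->
    ((T i)`_k == (T i)`_m) = (k == m).
  by move=> kl ml; have [sz [h _] _] := TP i; rewrite nth_uniq ?sz.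
pose g i y := if `[< E x y >] then (T i)`_(seq.index y (x :: l)) else y.
have gx i : g i x = (T i)`_0.
  by rewrite /g /= eqxx; case: asboolP => // /(_ (Erefl Xx)).
pose y i := (T i)`_(size l).+1.
have idx v : v \in x :: l -> (seq.index v (x :: l) < (size l).+1)%N.
  by rewrite -index_mem.
have xls v : v \in x :: l -> v \in [:: x, p, p' & l].
  by rewrite !inE => /orP[] ->; rewrite ?orbT.
have Eci (i : 'I_N) v : v \in [:: x, p, p' & l] -> X v -> ~ E (c i) v.
  by move=> vs Xv cv; apply: (cs i v vs); apply: Esym.
have gP i v : v \in x :: l -> X (g i v) /\
    ((E x v /\ E (c i) (g i v)) \/ (~ E x v /\ g i v = v)).
  move=> vl; rewrite /g; case: asboolP => xv; last by split; [apply: xlX|right].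
  by have [] := Tin i _ (leqW (idx _ vl)); split=> //; left.
have ginj (i : 'I_N) : {in x :: l &, injective (g i)}.
  move=> v w vl wl gvw.
  have [[_ gv] [_ gw]] := (gP i _ vl, gP i _ wl).
  case: gv => [[xv cv]|[nv gv]]; case: gw => [[xw cw]|[nw gw]].
  - move: gvw; rewrite /g (asboolT xv) (asboolT xw) => /eqP.
    rewrite Tuniq ?(leqW (idx _ _)) // => /eqP e.
    by rewrite -(nth_index 0 vl) e nth_index.
  - by case: (Eci i w (xls _ wl) (xlX _ wl)); rewrite -gw -gvw.
  - by case: (Eci i v (xls _ vl) (xlX _ vl)); rewrite -gv gvw.
  - by rewrite -gv gvw.
have yg (i : 'I_N) v : v \in x :: l -> y i != g i v.
  move=> vl; apply/eqP => yv; have [_ []] := gP i _ vl => [[xv _]|[nv gv]].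
    move: yv; rewrite /g (asboolT xv) => /eqP.
    rewrite Tuniq ?(leqW (idx _ _)) // => /eqP e.
    by have := idx _ vl; rewrite -e ltnn.
  have [_ cy] := Tin i _ (ltnSn (size l).+1).
  by case: (Eci i v (xls _ vl) (xlX _ vl)); rewrite -gv -yv.
have xl_p v : v \in x :: l -> (v == p = false) * (v == p' = false).
  rewrite inE => /predU1P[->|vl]; first by rewrite (negPf rp0) (negPf rp'0).
  by split; apply/eqP => vE; [move: pl|move: p'l]; rewrite -vE vl.
have pNx : ~ E x p by apply: sp; rewrite inE eqxx.
have fgeq (i j : 'I_N) : i != j ->
    gram (g i x :: g j x :: map (g i) l) = gram (g i x :: y j :: map (g i) l).
  move=> ij.
  (* The embedding that realizes the pattern: x and l go to their i-th copy,
     p and p' to the class c j. *)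
  pose f v := if v == p then g j x else if v == p' then y j else g i v.
  have fg v : v \in x :: l -> f v = g i v by move=> vl; rewrite /f !xl_p.
  have fC v : v \in [:: x, p, p' & l] -> X v /\ X (f v) /\
    [\/ E p v /\ E (c j) (f v), E x v /\ E (c i) (f v)
      | [/\ ~ E p v, ~ E x v & f v = v]].
    move=> vs; split; first exact: sX.
    have [vl|vl] := boolP (v \in x :: l).
      rewrite fg //; have [? [h|[h1 h2]]] := gP i _ vl; split=> //.
        by apply: Or32.
      apply: Or33; split=> // /Esym h; apply: (sp _ vl); apply: h => //.
      exact: sX.
    have : v = p \/ v = p'.
      move: vs vl; rewrite !inE negb_or => /or4P[->//|/eqP->|/eqP->|->];
        last by rewrite andbF.
        by left.
      by right.
    have [X0 c0] := Tin j 0%N isT.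
    have [Xy cy] := Tin j _ (ltnSn (size l).+1).
    case=> ->; rewrite /f ?eqxx ?[p' == p]eq_sym ?(negPf pp'0).
      by rewrite gx; split=> //; apply: Or31; split=> //; apply: Erefl.
    by split=> //; apply: Or31.
  have fE : {in [:: x, p, p' & l] &, forall v w, E v w <-> E (f v) (f w)}.
    move=> v w /[dup] vs /fC[Xv [Xfv hv]] /[dup] ws /fC[Xw [Xfw hw]].
    have sym m b m' b' : X m -> X b -> X m' -> X b' ->
        (E b m <-> E b' m') -> (E m b <-> E m' b').
      by move=> Xa Xb Xa' Xb' [h1 h2]; split=> /Esym h; apply: Esym => //;
         [apply: h1|apply: h2]; apply: h.
    have c12 m b : X m -> X b -> X (f m) -> X (f b) -> E p m -> E (c j) (f m) ->
        E x b -> E (c i) (f b) -> (E m b <-> E (f m) (f b)).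
      move=> Xa Xb Xfa Xfb pa ca xb cb; split=> ab; exfalso.
        by apply: pNx; apply: Etrans xb
          (Etrans (Esym ab _ _) (Esym pa _ _) _ _ _) _ _ _.
      apply: (cc _ _ ij).
      by apply: Etrans cb (Etrans (Esym ab _ _) (Esym ca _ _) _ _ _) _ _ _.
    have c3 m b (k : 'I_N) q : X m -> X b -> X (f m) ->
        b \in [:: x, p, p' & l] -> X q ->
        E q m -> E (c k) (f m) -> ~ E q b -> (E m b <-> E (f m) b).
      move=> Xa Xb Xfa bs Xq qa ca nqb; split=> ab; exfalso.
        by apply: nqb; apply: Etrans qa ab _ _ _.
      by apply: (Eci k b bs Xb); apply: Etrans ca ab _ _ _.
    case: hv => [[pv cv]|[xv cv]|[npv nxv fv]];
      case: hw => [[pw cw]|[xw cw]|[npw nxw fw]].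
    - split=> _; first by apply: Etrans (Esym cv _ _) cw _ _ _.
      by apply: Etrans (Esym pv _ _) pw _ _ _.
    - exact: c12.
    - by rewrite fw; apply: c3 pv cv npw.
    - by apply: sym => //; apply: c12.
    - split=> _; first by apply: Etrans (Esym cv _ _) cw _ _ _.
      by apply: Etrans (Esym xv _ _) xw _ _ _.
    - by rewrite fw; apply: c3 xv cv nxw.
    - by rewrite fv; apply: sym => //; apply: c3 pw cw npv.
    - by rewrite fv; apply: sym => //; apply: c3 xw cw nxv.
    - by rewrite fv fw.
  have finj : {in [:: x, p, p' & l] &, injective f}.
    move=> v w vs ws fvw; have vw : E v w.
      by apply/(fE _ _ vs ws); rewrite fvw; apply: Erefl;
        have [_ []] := fC _ ws.
    have [Xv _] := fC _ vs; have [Xw _] := fC _ ws.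
    have split_s m : m \in [:: x, p, p' & l] -> m \in x :: l \/ m = p \/ m = p'.
      rewrite !inE => /or4P[->|/eqP->|/eqP->|->];
        [by left|by right; left|by right; right|by left; rewrite orbT].
    have nE m b : m \in x :: l -> b = p \/ b = p' -> X m -> E m b -> False.
      move=> al [] -> Xa ab; apply: (sp _ al) => //.
      by apply: Etrans ab (Esym pp' _ _) _ _ _.
    have y0 : y j != g j x by apply: yg; rewrite inE eqxx.
    have p'p : (p' == p) = false by rewrite eq_sym (negPf pp'0).
    case: (split_s _ vs) => [vl|vp]; case: (split_s _ ws) => [wl|wp].
    - by apply: (ginj i) => //; rewrite -!fg.
    - by case: (nE v w).
    - by case: (nE w v) => //; apply: Esym.
    - move: fvw; rewrite /f; case: vp => ->; case: wp => ->;
        rewrite ?eqxx ?p'p // => e.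
        by rewrite e eqxx in y0.
      by rewrite e eqxx in y0.
  have [||||_ [h _]] := @gram_indiscernible _ _ _ _ hind
    [:: x, p, p' & l] f us _ _ fE
    [:: x, p & l] [:: x, p' & l] (size l).+2 sd erefl erefl.
  - by rewrite map_inj_in_uniq.
  - by move=> v /fC[? []].
  - by move=> v; rewrite !inE => /or3P[] ->; rewrite ?orbT.
  - by move=> v; rewrite !inE => /or3P[] ->; rewrite ?orbT.
  have := h geq; rewrite /= fg ?mem_head //.
  have -> : map f l = map (g i) l.
    by apply/eq_in_map => v vl; apply: fg; rewrite inE vl orbT.
  by rewrite /f !eqxx [p' == p]eq_sym (negPf pp'0).
have uxl : uniq (x :: l) by rewrite /= rl.
have ug i : uniq (map (g i) (x :: l)).
  by rewrite map_inj_in_uniq //; apply: ginj.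
have gX i : {in map (g i) (x :: l), forall v, X v}.
  by move=> v /mapP[w wl ->]; have [] := gP i _ wl.
apply: (@no_gram_family _ _ N (fun i => g i x) y (fun i => map (g i) l)).
- exact: ltnSn.
- move=> i; apply: gram_uniq_neq0; [exact: ug|exact: gX|].
  by rewrite /= size_map ltnW.
- move=> i; pose v := y i :: map (g i) (x :: l).
  rewrite (@gram_perm _ _ _ v); last first.
    by rewrite (perm_catCA [:: _] [:: _]).
  apply: gram_uniq_neq0; last by rewrite /= size_map.
    rewrite cons_uniq ug andbT; apply/mapP => -[w wl /eqP].
    by apply/negP; apply: yg.
  move=> w; rewrite inE => /predU1P[->|/gX//].
  by have [] := Tin i _ (ltnSn (size l).+1).
- exact: fgeq.
Qed.

(** A point p of A outside B can be moved in its class without changing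
    gram B, hence without changing gram A. *)
Lemma gram_eq_subset A B : uniq A ->
  {in A, forall x, X x} -> {in B, forall x, X x} -> size A = size B ->
  (2 <= size A <= a)%N -> gram A = gram B -> {subset A <= B}.
Proof.
move=> uA AX BX szAB /andP[szA2 szAa] gAB p pA; apply: contraPP gAB => /negP pB.
have szA : (2 <= size A <= d.+1)%N.
  by rewrite szA2 (leq_trans szAa) //; case/andP: a2.
have Xp := AX _ pA; have pAp := perm_to_rem pA.
case: (rem p A) pAp => [/perm_size sz1|x l pAp]; first by rewrite sz1 in szA2.
have swap q r k : perm_eq [:: q, r & k] [:: r, q & k].
  by rewrite (perm_catCA [:: _] [:: _]).
have Apx := perm_trans pAp (swap p x l); rewrite (gram_perm Apx).
rewrite (perm_uniq Apx) in uA; have szAl := perm_size Apx.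
(* Fresh with respect to B as well, so that the substitution leaves B alone. *)
have [p' [Xp' pp' /[!mem_cat]/norP[p'A p'B]]] := fresh_in_class (A ++ B) Xp.
rewrite (perm_mem Apx) !inE !negb_or in p'A.
have /and3P[p'x p'p p'l] := p'A.
have /and3P[/[!inE]/norP[xp xl] pl ul] := uA.
have AX' : {in [:: x, p & l], forall y, X y}.
  by move=> y; rewrite -(perm_mem Apx) => /AX.
move=> gAB; have {gAB} : gram [:: x, p & l] = gram [:: x, p' & l].
  rewrite gAB.
  have := @gram_eq_subst p p' (undup (x :: l ++ B)) [:: x, p & l] B.
  rewrite [map _ [:: x, p & l]]/= eqxx (negPf xp) !map_subst // => -> //.
  - rewrite cons_uniq undup_uniq mem_undup inE mem_cat !negb_or.
    by rewrite eq_sym xp pl pB.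
  - by rewrite mem_undup inE mem_cat !negb_or p'x p'l.
  - move=> y; rewrite mem_undup inE mem_cat => /or3P[/eqP->|yl|/BX//].
      by apply: AX'; rewrite inE eqxx.
    by apply: AX'; rewrite !inE yl !orbT.
  - by rewrite -szAl.
  - by rewrite -szAl.
  - move=> y; rewrite !inE mem_undup inE mem_cat.
    by move=> /or3P[] ->; rewrite ?orbT.
  - by move=> y yB; rewrite inE mem_undup inE mem_cat yB !orbT.
have sza : ((size l).+2 <= a)%N by rewrite szAl in szAa.
have u4 : uniq [:: x, p, p' & l].
  have ul' : uniq l := ul.
  rewrite !cons_uniq !inE !negb_or xp xl pl p'l ul' [x == p']eq_sym p'x.
  by rewrite [p == p']eq_sym p'p.
have X4 : {in [:: x, p, p' & l], forall y, X y}.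
  move=> y; rewrite !inE => /or4P[/eqP->|/eqP->//|/eqP->//|yl].
    by apply: AX'; rewrite inE eqxx.
  by apply: AX'; rewrite !inE yl !orbT.
have [/hasP[r rl /asboolP rp]|/hasPn nl] :=
    boolP (has (fun r => `[< E r p >]) (x :: l)); last first.
  by apply: gram_neq_other_class => // r /nl /asboolPn.
have prl := perm_to_rem rl.
have pmv q : perm_eq [:: x, q & l] [:: r, q & rem r (x :: l)].
  rewrite (permPl (swap _ _ _)) (permPr (swap _ _ _)) perm_cons.
  exact: prl.
rewrite !(gram_perm (pmv _)).
have p4 : perm_eq [:: x, p, p' & l] [:: r, p, p' & rem r (x :: l)].
  rewrite (perm_catCA [:: x] [:: p; p'] l).
  rewrite perm_sym (perm_catCA [:: r] [:: p; p'] (rem r (x :: l))).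
  by rewrite perm_sym perm_cat2l.
apply: gram_neq_same_class => //.
- by rewrite -(perm_uniq p4).
- by move=> y; rewrite -(perm_mem p4) => /X4.
- by rewrite size_rem.
Qed.

End IndependentClass.
End Combinatorics.

(** * Maximal independent lists in a class *)

Theorem theorem3p4 (R : realType) (d : nat) (hd : (1 <= d)%N)
    (X : set 'rV[R]_d) (E : 'rV[R]_d -> 'rV[R]_d -> Prop)
    (hE : equivalence_on X E)
    (hclasses : infinite_set (eclasses X E))
    (hclass : forall C, eclasses X E C -> infinite_set C)
    (hind : Delta_indiscernible (to_complex @` X) (rel_to_complex E)) :
  exists a : nat,
    [/\ (2 <= a <= d.+1)%N,
        forall C, eclasses X E C -> strictly_rainbow a C
      & forall b : nat, (2 <= b <= a)%N -> strongly_rainbow b X].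
Proof.
pose P n := `[< exists x t,
  [/\ X x, class_seq X E x t, size t = n & gram t != 0] >].
have P2 : P 2%N.
  have [_ [x Xx _] _] := infinite_notin [::] hclasses.
  have [y [Xy xy yx]] := fresh_in_class hclass [:: x] Xx; rewrite inE in yx.
  case: (hE) => Erefl _ _; apply/asboolP; exists x, [:: x; y]; split=> //.
    split; first by rewrite /= andbT inE eq_sym.
    by move=> z; rewrite !inE => /orP[]/eqP->; split=> //; apply: Erefl.
  apply/eqP => /gram_cons2_eq0; rewrite gram1 oner_eq0 => /(_ isT)/submxP[v].
  by rewrite [edge_mx _]flatmx0 mulmx0 => /subr0_eq/eqP; apply/negP.
have [a /asboolP[x0 [t0 [Xx0 t0C szt0 gt0]]] amax] :
    exists2 a, P a & forall n, P n -> (n <= a)%N.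
  have Pd n : P n -> (n <= d.+1)%N.
    by move=> /asboolP[x [t [_ _ <- /gram_size_le]]].
  have exP : exists n, P n by exists 2%N.
  by case: (ex_maxnP exP Pd) => a Pa amax; exists a.
have a2 : (2 <= a <= d.+1)%N by rewrite amax //= -szt0 gram_size_le.
have strongX b : (2 <= b <= a)%N -> strongly_rainbow b X.
  move=> bP; split=> [A AX szA|A B AX BX szA szB AB].
    apply: volume_neq0.
    apply: (gram_uniq_neq0 hE hclass hind a2 Xx0 t0C szt0 gt0).
    - exact: fset_uniq.
    - by move=> x /AX.
    - by rewrite [size _]szA; case/andP: bP => /ltnW-> ->.
  rewrite -szB in szA; move=> /(volume_inj szA) gAB; apply: AB.
  apply/eqP; rewrite eqEfcard szA leqnn andbT; apply/fsubsetP.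
  apply: (gram_eq_subset hE hclasses hclass hind a2 Xx0 t0C szt0 gt0) gAB => //.
  - exact: fset_uniq.
  - by rewrite szA szB.
exists a; split=> // _ [x Xx <-]; split.
  move=> b /strongX; apply: strongly_rainbow_subset.
  by move=> y [].
have [[//|p l] [szt tC _]] := fresh_class_seq hclass [::] a Xx.
  by rewrite -[a]szt in a2.
have g0 := gram_class_neq0 hE hind a2 Xx0 t0C szt0 gt0 Xx tC szt.
have [W dimW WP] := edge_vspace g0.
exists p, W; split; first by rewrite dimW -szt.
move=> z [Xz xz]; apply: WP.
have [zl|zl] := boolP (z \in p :: l); first exact: mem_edge_mx.
apply: gram_cons2_eq0 => //; apply/eqP; apply: contraT => gz.
suff /amax : P a.+1 by rewrite ltnn.
apply/asboolP; exists x, [:: p, z & l]; split=> //; last by rewrite -szt.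
case: tC => upl plX; move: zl upl; rewrite !cons_uniq !inE negb_or.
move=> /andP[zp zl] /andP[pl ul]; split.
  by rewrite !cons_uniq inE negb_or eq_sym zp pl zl.
move=> y; rewrite !inE => /or3P[/eqP->|/eqP->//|yl]; apply: plX;
  by rewrite inE ?eqxx ?yl ?orbT.
Qed.
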